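(* Let $\alpha>0$, let $f\in\mathcal{F}_L(\mathbb{R}_+^N)$, suppose $\nabla f$ is $B$-bounded, let $x(0)\in\mathbb{R}_+^N$, and let $x(t)$ be generated with constant step-size $\gamma$ by $$x(t+1)=\left\lceil x(t)-\frac{\gamma}{\sqrt{N}}\,\mathrm{sign}(\nabla f(x(t)))\right\rceil^+,\qquad t=0,1,2,\ldots$$ For $\epsilon>0$ define $\bar{\mathcal{X}}_\alpha(\epsilon)=\{x\in\mathbb{R}_+^N : L_\alpha(x)\leq\epsilon\}$, where $L_\alpha(x)=\|x-\lceil x-\alpha\nabla f(x)\rceil^+\|$. Then for any $\epsilon>0$ and any $\gamma\in\left(0,\,2\epsilon^2/(L\alpha^2 B N^{3/2})\right)$ there exists a nonnegative integer $T$ such that $x(T)\in\bar{\mathcal{X}}_\alpha(\epsilon)$, with $T$ bounded by $$T\leq\left\lceil\frac{2(f(x(0))-f^\star)\,\alpha^2 B N^{3/2}}{\gamma\,(2\epsilon^2-L\gamma\alpha^2 B N^{3/2})}\right\rceil .$$ This upper bound is minimized (over such $\gamma$) when the step-size $\gamma^\star=\epsilon^2/(L\alpha^2 B N^{3/2})$ is used.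
   Context: $\mathbb{R}_+=[0,\infty)$, $N\geq1$, $L>0$, $B>0$, and $\|\cdot\|$ is the Euclidean norm. $\lceil\cdot\rceil^+$ denotes the (componentwise) projection onto $\mathbb{R}_+^N$, i.e. $(\lceil x\rceil^+)_i=\max\{x_i,0\}$; the brackets $\lceil\cdot\rceil$ without superscript $+$ in the bound for $T$ denote the usual ceiling function. $\mathrm{sign}$ acts componentwise with values in $\{-1,1\}$: $\mathrm{sign}(z)=1$ if $z>0$, $\mathrm{sign}(z)=-1$ if $z<0$, and $\mathrm{sign}(0)\in\{-1,1\}$ is an arbitrary fixed value. Class $\mathcal{F}_L(\mathbb{R}_+^N)$: $f\in\mathcal{F}_L(\mathbb{R}_+^N)$ means $f:\mathbb{R}^N\to\mathbb{R}$ is convex and differentiable with $L$-Lipschitz continuous gradient, and the solution set $\mathcal{X}^\star$ of the problem of minimizing $f(x)$ subject to $x\in\mathbb{R}_+^N$ is nonempty and bounded; $f^\star$ is the optimal value of this problem. $\nabla f$ is $B$-bounded if $\|\nabla f(x)\|\leq B$ for all $x\in\mathbb{R}_+^N$. *)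

(* Defs.v *)
From mathcomp Require Export all_boot all_order all_algebra.
From mathcomp Require Export all_classical all_reals all_analysis.

Set Implicit Arguments.
Unset Strict Implicit.
Unset Printing Implicit Defensive.

Export Order.TTheory GRing.Theory Num.Theory.
Export numFieldNormedType.Exports.
#[global] Open Scope classical_set_scope.
#[global] Open Scope ring_scope.

Section Defs.
Context {R : realType} {N : nat}.
Implicit Types (x y : 'rV[R]_N) (f : 'rV[R]_N -> R).

(* The library norm on ['rV[R]_N] is the sup norm; differentiability and
   [bounded_set] below do not depend on the choice of an equivalent norm. *)
Definition enorm x : R := Num.sqrt (\sum_i x 0 i ^+ 2).

Definition orthant : set 'rV[R]_N := [set x | forall i, 0 <= x 0 i].

Definition proj_orthant x : 'rV[R]_N := \row_i Num.max (x 0 i) 0.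

Definition gradient f x : 'rV[R]_N := \row_i 'D_(delta_mx 0 i) f x.

(* [s0] is the value of the sign at 0. *)
Definition sign (s0 z : R) : R := if z == 0 then s0 else Num.sg z.

Definition sign_vec (s0 : R) x : 'rV[R]_N := \row_i sign s0 (x 0 i).

Definition solutions f : set 'rV[R]_N :=
  [set x | orthant x /\ forall y, orthant y -> f x <= f y].

Definition optimal_value f : R := inf (f @` orthant).

Record F_class (L : R) f : Prop := {
  F_convex : convex_function [set: convex_lmodType 'rV[R]_N] f ;
  F_differentiable : forall x, differentiable f x ;
  F_lipschitz : forall x y,
    enorm (gradient f x - gradient f y) <= L * enorm (x - y) ;
  F_solutions_nonempty : solutions f !=set0 ;
  F_solutions_bounded : bounded_set (solutions f)
}.

Definition gradient_bounded (B : R) f : Prop :=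
  forall x, orthant x -> enorm (gradient f x) <= B.

Definition residual (alpha : R) f x : R :=
  enorm (x - proj_orthant (x - alpha *: gradient f x)).

Definition approx_solutions (alpha : R) f (eps : R) : set 'rV[R]_N :=
  [set x | orthant x /\ residual alpha f x <= eps].

Definition sign_step (s0 gamma : R) f x : 'rV[R]_N :=
  proj_orthant
    (x - (gamma / Num.sqrt N%:R) *: sign_vec s0 (gradient f x)).

End Defs.

Definition iteration_bound {R : realType} (N : nat) (L B alpha eps : R)
    (f : 'rV[R]_N -> R) (x0 : 'rV[R]_N) (gamma : R) : int :=
  Num.ceil
    ((2 * (f x0 - optimal_value f) * alpha ^+ 2 * B * N%:R `^ (3 / 2))
     / (gamma *
        (2 * eps ^+ 2 - L * gamma * alpha ^+ 2 * B * N%:R `^ (3 / 2)))).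

(* Main.v *)
Require Import Defs.
From mathcomp Require Import ring lra zify.

(** Write g for the gradient at the current point x, d for the displacement
    to the next point x', e = eps / alpha, a = gamma / sqrt N for the length
    of an unclipped coordinate move, and h = e ^ 2 / (N B).  Every coordinate
    moves against the sign of g, so <g, d> is minus the sum of |g_i| |d_i|,
    and Taylor's inequality for an L-Lipschitz gradient gives
      f(x') <= f(x) - sum |g_i| |d_i| + (L / 2) N a ^ 2.
    The claimed bound on T is the ceiling of (f(x(0)) - f^star) / delta with
    delta = a h - (L / 2) N a ^ 2, so an iteration makes enough progress when
      sum |g_i| |d_i| >= a h.

    The residual is at most alpha |g| <= alpha B, so either x(0) is already an
    eps-solution or e < B, whence N h <= e.  If no coordinate is clipped, the
    sum is a times a quantity larger than e, which is enough.  A coordinate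
    closer than a to the boundary may move by less than a, however, and a
    single iteration may then decrease f by less than delta while the
    residual still exceeds eps.  The point of the proof is that such an
    iteration is the last one ([sign_step_progress]): if the residual exceeds
    eps at x and also at x', then the sum is at least a h.  Suppose it is not.
    A clipped coordinate lands on 0 with g_i >= 0, where its new residual is
    at most alpha times the change of its partial derivative.  The residual
    at x' is therefore at most alpha (G + |g' - g|), with g' the gradient at
    x' and G the sum of |g_i| over the unclipped coordinates; the first term
    is below h, the second is at most L |d|, and gamma < gamma_max means
    L a N < 2 h.  For N >= 3 crude estimates of both terms suffice; weighing
    them against the smallest move m = min |d_i| makes one computation cover
    N = 2 as well ([short_step_arith]).  For N = 1 the clipped coordinate is
    the only one and keeps g' >= - e, because g > e and |g' - g| < 2 h <= 2 e.

    To conclude, let n be the bound on T.  If the residual exceeded eps at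
    all times t <= n, then all the steps before n would decrease f by delta,
    hence f(x(n)) <= f(x(0)) - n delta <= f^star.  So x(n) would be a
    minimizer, and the residual vanishes at minimizers
    ([minimizer_residual0]).

    The bound as a function of gamma is smallest when the denominator
    gamma (2 eps ^ 2 - M gamma), M = L alpha ^ 2 B N ^ (3/2), is largest; it
    is a concave quadratic with vertex eps ^ 2 / M. *)

(** * The Euclidean norm *)

Section EuclideanNorm.
Context {R : realType} {N : nat}.
Implicit Types x y : 'rV[R]_N.

Lemma enorm_ge0 x : 0 <= enorm x.
Proof. exact: sqrtr_ge0. Qed.

Lemma sqr_enorm x : enorm x ^+ 2 = \sum_i x 0 i ^+ 2.
Proof. by rewrite sqr_sqrtr// sumr_ge0// => i _; rewrite sqr_ge0. Qed.

Lemma enorm_le x y : (forall i, `|x 0 i| <= `|y 0 i|) -> enorm x <= enorm y.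
Proof.
move=> h; apply: ler_wsqrtr; apply: ler_sum => i _.
rewrite -[x 0 i ^+ 2]real_normK ?num_real// -[y 0 i ^+ 2]real_normK ?num_real//.
by rewrite lerXn2r ?nnegrE.
Qed.

Lemma enormZ (c : R) x : 0 <= c -> enorm (c *: x) = c * enorm x.
Proof.
move=> c0; rewrite /enorm.
under eq_bigr do rewrite mxE exprMn.
by rewrite -mulr_sumr sqrtrM ?sqr_ge0// sqrtr_sqr ger0_norm.
Qed.

(** The quadratic form sum (s x_i - t y_i) ^ 2 is nonnegative. *)
Lemma cauchy_schwarz x y : \sum_i x 0 i * y 0 i <= enorm x * enorm y.
Proof.
apply: ler_normlW.
rewrite -ler_sqr ?nnegrE ?mulr_ge0 ?enorm_ge0// real_normK ?num_real//.
rewrite exprMn !sqr_enorm.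
set S := \sum_i _ * _; set X := \sum_i x 0 i ^+ 2; set Y := \sum_i _ ^+ 2.
have X0 : 0 <= X by apply: sumr_ge0 => i _; exact: sqr_ge0.
have Y0 : 0 <= Y by apply: sumr_ge0 => i _; exact: sqr_ge0.
have quad s t : 0 <= s ^+ 2 * X - 2 * s * t * S + t ^+ 2 * Y.
  have -> : s ^+ 2 * X - 2 * s * t * S + t ^+ 2 * Y =
      \sum_i (s * x 0 i - t * y 0 i) ^+ 2.
    rewrite !mulr_sumr -sumrB -big_split /=; apply: eq_bigr => i _; ring.
  by apply: sumr_ge0 => i _; exact: sqr_ge0.
(* Minimizing in s : t suggests (S, X); when X = 0 the form is linear in s
   and two values of s force S = 0. *)
have [Xp|] := ltP 0 X; last by move: (quad 1 S) (quad (1+Y) S); nra.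
by have := quad S X; nra.
Qed.

Lemma enormD x y : enorm (x + y) <= enorm x + enorm y.
Proof.
rewrite -ler_sqr ?nnegrE ?addr_ge0 ?enorm_ge0// sqrrD !sqr_enorm.
have -> : \sum_i (x + y) 0 i ^+ 2 =
    \sum_i x 0 i ^+ 2 + 2 * (\sum_i x 0 i * y 0 i) + \sum_i y 0 i ^+ 2.
  rewrite mulr_sumr -!big_split /=; apply: eq_bigr => i _; rewrite mxE; ring.
by have := cauchy_schwarz x y; rewrite mulr2n; lra.
Qed.

Lemma enorm_le_sum x : enorm x <= \sum_i `|x 0 i|.
Proof.
rewrite -ler_sqr ?nnegrE ?enorm_ge0 ?sumr_ge0// sqr_enorm expr2 mulr_suml.
apply: ler_sum => i _; rewrite -real_normK ?num_real// expr2 ler_wpM2l//.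
by rewrite (bigD1 i)//= lerDl sumr_ge0.
Qed.

End EuclideanNorm.

(** * Taylor's inequality for a Lipschitz gradient *)

Section Descent.
Context {R : realType} {N : nat}.
Implicit Types (x y d : 'rV[R]_N) (f : 'rV[R]_N -> R).

Lemma derive_gradient f x d : differentiable f x ->
  'D_d f x = \sum_i gradient f x 0 i * d 0 i.
Proof.
move=> df; rewrite deriveE// [in LHS](row_sum_delta d) linear_sum.
by apply: eq_bigr => i _; rewrite linearZ mxE deriveE// mulrC.
Qed.

(** Both sides are limits of the same difference quotient. *)
Lemma is_derive_line f x d (t : R) : differentiable f (x + t *: d) ->
  is_derive t 1 (fun s : R => f (x + s *: d)) ('D_d f (x + t *: d)).
Proof.
move=> df.
pose p := x + t *: d; pose line s := f (x + s *: d).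
have eqq :
    (fun h : R => h^-1 *: ((line \o shift t) (h *: (1 : R)) - line t)) =
    (fun h : R => h^-1 *: ((f \o shift p) (h *: d) - f p)).
  apply/funext => h /=; congr (_ *: (f _ - _)).
  by rewrite [h *: 1]mulr1 scalerDl addrCA.
have dv := @diff_derivable _ _ _ f p d df.
by split; [rewrite /derivable eqq|rewrite /derive /= eqq].
Qed.

(** Along the segment from x to y, the gap between f and its quadratic upper
    model is nonincreasing: its derivative is controlled by Cauchy-Schwarz and
    the Lipschitz bound. *)
Lemma descent_lemma L f x y : (forall z, differentiable f z) ->
  (forall z w, enorm (gradient f z - gradient f w) <= L * enorm (z - w)) ->
  f y <= f x + \sum_i gradient f x 0 i * (y - x) 0 i
         + L / 2 * enorm (y - x) ^+ 2.
Proof.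
move=> df lip; set d := y - x.
set S := \sum_i _; set E := enorm d.
pose psi (t : R) : R := f (x + t *: d) - t * S - L / 2 * E ^+ 2 * (t * t).
pose dpsi (t : R) : R := 'D_d f (x + t *: d) - S - L * E ^+ 2 * t.
have D (t : R) : is_derive t (1 : R) psi (dpsi t).
  have h := is_derive_line _ _ _ _ (df (x + t *: d)).
  have -> : psi = (fun s => f (x + s *: d)) - (S *: id)
                  - (L / 2 * E ^+ 2) *: (id * id).
    apply/funext => s; rewrite /psi !fctE; congr (_ - _ - _).
    by rewrite [_ *: _]mulrC.
  apply: is_derive_eq; rewrite /dpsi /=.
  by rewrite /GRing.scale /=; field.
have cnt : {within `[0, 1], continuous psi}.
  by apply: derivable_within_continuous => z _; have [] := D z.
have [c] := MVT (@ltr01 R) (fun t _ => D t) cnt.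
rewrite in_itv /= => /andP[c0 c1].
rewrite /psi scale1r scale0r addr0 subr0 mulr1 !mul0r mulr0 !subr0 !mul1r mulr1.
rewrite [x + d]addrC subrK => psiE.
suff : dpsi c <= 0 by move: psiE; lra.
rewrite /dpsi derive_gradient// /S -sumrB.
under eq_bigr do rewrite -mulrBl.
rewrite subr_le0.
pose u := gradient f (x + c *: d) - gradient f x.
have -> : \sum_i (gradient f (x + c *: d) 0 i - gradient f x 0 i) * d 0 i
   = \sum_i u 0 i * d 0 i by apply: eq_bigr => i _; rewrite !mxE.
apply: (le_trans (cauchy_schwarz _ _)).
have := lip (x + c *: d) x.
rewrite [x + _]addrC addrK enormZ ?(ltW c0)// -/E [_ + x]addrC -/u => h.
have E0 : 0 <= E by exact: enorm_ge0.
by nra.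
Qed.
End Descent.

(** * The iteration in one coordinate *)

Section Coordinate.
Context {R : realType}.
Implicit Types x g a alpha : R.

Lemma maxr0P x : (0 <= x /\ Num.max x 0 = x) \/ (x <= 0 /\ Num.max x 0 = 0).
Proof.
by case: (leP x 0) => h; [right | left]; split=> //; exact: ltW.
Qed.

Lemma sign_cases (s0 : R) g : s0 = 1 \/ s0 = -1 ->
  (0 <= g /\ sign s0 g = 1) \/ (g <= 0 /\ sign s0 g = -1).
Proof.
move=> hs; rewrite /sign; case: eqVneq => [->|gn0].
  by case: hs => ->; [left|right].
case: (ltrgtP g 0) gn0 => // h _.
  by right; rewrite ltr0_sg// ltW.
by left; rewrite gtr0_sg// ltW.
Qed.

(** One coordinate of the iteration.  A move shorter than a can only be caused
    by the projection, so it ends at 0 and goes downwards. *)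
Lemma sign_step_coord (s0 : R) a x g : s0 = 1 \/ s0 = -1 -> 0 < a -> 0 <= x ->
  let x' := Num.max (x - a * sign s0 g) 0 in
  [/\ `|x' - x| <= a, g * (x' - x) = - (`|g| * `|x' - x|) &
      `|x' - x| < a -> x' = 0 /\ 0 <= g].
Proof.
move=> hs a0 x0 /=.
have [[g0 ->]|[g0 ->]] := sign_cases s0 g hs; rewrite ?mulr1 ?mulrN1 ?opprK.
- rewrite (ger0_norm g0).
  have [[h ->]|[h ->]] := maxr0P (x - a).
    have -> : x - a - x = - a by ring.
    by rewrite normrN (gtr0_norm a0) ltxx; split=> //; ring.
  rewrite sub0r normrN (ger0_norm x0); split=> //; [lra|ring].
- rewrite (ler0_norm g0) max_l; last lra.
  have -> : x + a - x = a by ring.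
  by rewrite (gtr0_norm a0) ltxx; split=> //; ring.
Qed.

Lemma residual_coord_le alpha x g : 0 < alpha -> 0 <= x ->
  `|x - Num.max (x - alpha * g) 0| <= alpha * `|g|.
Proof.
move=> al x0; rewrite -{2}(gtr0_norm al) -normrM.
by have [[h ->]|[h ->]] := maxr0P (x - alpha * g);
  rewrite ler_normr; case: (ler0P (x - _)); lra.
Qed.

(** On the boundary, a positive partial derivative contributes nothing to the
    residual. *)
Lemma residual_coord_at0 alpha g : 0 < alpha ->
  `|0 - Num.max (0 - alpha * g) 0| <= alpha * Num.max (- g) 0.
Proof.
move=> al.
by have [[h ->]|[h ->]] := maxr0P (0 - alpha * g);
  have [[k ->]|[k ->]] := maxr0P (- g);
  rewrite !sub0r ?opprK ?oppr0 ?normr0 ?ler_norml; nra.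
Qed.

(** The projected gradient step of length 1 / L, coordinate by coordinate: the
    projection inequality d (d + g / L) <= 0, rearranged. *)
Lemma prox_coord L x g : 0 < L -> 0 <= x ->
  let d := Num.max (x - L^-1 * g) 0 - x in
  g * d + L / 2 * d ^+ 2 <= - (L / 2 * d ^+ 2).
Proof.
move=> L0 x0 /=.
have [k ->] : exists k, g = L * k by exists (L^-1 * g); rewrite mulVKf// gt_eqF.
rewrite mulKf ?gt_eqF//.
have [[h ->]|[h ->]] := maxr0P (x - k); last first.
  have kx : 0 <= k - x by lra.
  have := mulr_ge0 (mulr_ge0 (ltW L0) x0) kx; rewrite sub0r sqrrN expr2; lra.
have -> : x - k - x = - k by ring.
by rewrite le_eqVlt; apply/orP; left; apply/eqP; field.
Qed.

(** The fixed points of a projected gradient step are the stationary points,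
    whatever the step length. *)
Lemma prox_coord_fixed alpha beta x g : 0 < alpha -> 0 < beta -> 0 <= x ->
  Num.max (x - beta * g) 0 = x -> Num.max (x - alpha * g) 0 = x.
Proof.
move=> al be x0.
have [[h ->]|[h ->]] := maxr0P (x - beta * g) => e;
have [[k ->]|[k ->]] := maxr0P (x - alpha * g) => //.
- have : g = 0 by nra.
  by move=> ->; ring.
- have : g = 0 by nra.
  by move=> g0; subst g; lra.
- by nra.
Qed.
End Coordinate.

(** * First-order progress of a sign step *)

Section Progress.
Context {R : realType}.

(** The contradiction at the heart of [sign_step_progress].  There k is the
    dimension, n the norm of the displacement, m the length of its shortest
    coordinate and G the sum of |g_i| over the unclipped coordinates.  The
    estimate n <= k a / 2 + m isolates m, whose contribution L m is absorbed
    by the decrease m (e - G) available on the clipped coordinates. *)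
Lemma short_step_arith (L a m e h G n k : R) :
  0 < L -> 0 < a -> 0 <= m <= a -> 0 <= n -> 2 <= k ->
  L * a * k < 2 * h -> h * k <= e ->
  n ^+ 2 <= m ^+ 2 + (k - 1) * a ^+ 2 -> a * G + m * (e - G) < a * h ->
  G + L * n <= e.
Proof.
move=> L0 a0 /andP[m0 ma] n0 k2 Lak hk hn hG.
have La0 : 0 < L * a by exact: mulr_gt0.
have h0 : 0 < h by nra.
have h2 : 2 * h <= e by nra.
have Lah : L * a < h by nra.
have Gh : G < h.
  rewrite ltNge; apply/negP => Gh.
  have [eG|eG] := leP G e.
    have : 0 <= m * (e - G) by apply: mulr_ge0 => //; lra.
    by have : a * h <= a * G; [rewrite ler_pM2l|lra].
  have : a * (e - G) <= m * (e - G) by rewrite ler_wnM2r//; lra.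
  by have : a * h < a * e; [rewrite ltr_pM2l//; lra|lra].
(* AM-GM in the form k - 1 <= (k / 2) ^ 2. *)
have nle : n <= k / 2 * a + m.
  have r0 : 0 <= k / 2 * a + m by rewrite addr_ge0// mulr_ge0; lra.
  rewrite -ler_sqr ?nnegrE//; apply: (le_trans hn).
  have : 0 <= (k / 2 - 1) ^+ 2 * a ^+ 2 by rewrite mulr_ge0// sqr_ge0.
  have : 0 <= k * a * m by rewrite !mulr_ge0; lra.
  by lra.
have Ln : a * (L * n) <= a * (L * (k / 2 * a + m)).
  by rewrite !ler_pM2l.
rewrite -(ler_pM2l a0).
have P1 : m * (L * a) <= m * (e - G) by rewrite ler_wpM2l//; lra.
have P2 : a * (L * a * k) < a * (2 * h) by rewrite ltr_pM2l.
have P3 : a * (2 * h) <= a * e by rewrite ler_pM2l.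
by lra.
Qed.

Context {N : nat}.
Implicit Types (x g d : 'rV[R]_N) (f : 'rV[R]_N -> R).

Lemma proj_residual_coord (c : R) x g i :
  (x - proj_orthant (x - c *: g)) 0 i
  = x 0 i - Num.max (x 0 i - c * g 0 i) 0.
Proof. by rewrite !mxE. Qed.

Lemma scale_coord (c : R) x i : (c *: x) 0 i = c * x 0 i.
Proof. by rewrite mxE. Qed.

Lemma sub_coord x g i : (x - g) 0 i = x 0 i - g 0 i.
Proof. by rewrite !mxE. Qed.

Lemma sign_step_coordE (s0 gamma : R) f x i :
  sign_step s0 gamma f x 0 i =
  Num.max (x 0 i - gamma / Num.sqrt N%:R * sign s0 (gradient f x 0 i)) 0.
Proof. by rewrite /sign_step; move: (gradient f x) => g; rewrite !mxE. Qed.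

Lemma sign_step_orthant (s0 gamma : R) f x : orthant (sign_step s0 gamma f x).
Proof. by move=> i; rewrite sign_step_coordE le_max lexx orbT. Qed.

Lemma residual_le_gradient (alpha : R) f x : 0 < alpha -> orthant x ->
  residual alpha f x <= alpha * enorm (gradient f x).
Proof.
move=> al ox; rewrite -enormZ ?(ltW al)//; apply: enorm_le => i.
rewrite proj_residual_coord scale_coord normrM (gtr0_norm al).
exact: residual_coord_le.
Qed.

(** Compare a minimizer with its projected gradient step of length 1 / L:
    [descent_lemma] and [prox_coord] make the latter strictly better unless it
    is the same point. *)
Lemma minimizer_residual0 (L alpha : R) f x : 0 < L -> 0 < alpha ->
  F_class L f -> solutions f x -> residual alpha f x = 0.
Proof.
move=> L0 al hf [ox opt].
set y := proj_orthant (x - L^-1 *: gradient f x).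
have oy : orthant y by move=> i; rewrite /y mxE le_max lexx orbT.
have yE i : (y - x) 0 i = Num.max (x 0 i - L^-1 * gradient f x 0 i) 0 - x 0 i.
  by rewrite -[y - x]opprB mxE proj_residual_coord opprB.
have fy := opt _ oy.
have := descent_lemma L f x y (F_differentiable hf) (F_lipschitz hf).
rewrite sqr_enorm mulr_sumr -addrA -big_split /= => dec.
have d0 : \sum_i (y - x) 0 i ^+ 2 <= 0.
  have : \sum_i (gradient f x 0 i * (y - x) 0 i + L / 2 * (y - x) 0 i ^+ 2)
     <= - (L / 2 * \sum_i (y - x) 0 i ^+ 2).
    rewrite mulr_sumr -sumrN; apply: ler_sum => i _.
    by rewrite yE; exact: prox_coord.
  by have : 0 < L / 2; [lra|nra].
have fixed i : (y - x) 0 i = 0.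
  apply/eqP; rewrite -sqrf_eq0 eq_le sqr_ge0 andbT (le_trans _ d0)//.
  by rewrite (bigD1 i)//= lerDl sumr_ge0// => j _; exact: sqr_ge0.
apply/eqP; rewrite -sqrf_eq0 sqr_enorm big1// => i _.
rewrite proj_residual_coord (@prox_coord_fixed _ alpha L^-1) ?invr_gt0//.
  by rewrite subrr expr0n.
by apply/eqP; rewrite -subr_eq0 -yE fixed.
Qed.

(** A step whose first-order decrease falls short of a h is so much clipped
    that the next point is already an eps-solution. *)
Lemma sign_step_progress (L alpha s0 gamma e h : R) f x :
  (0 < N)%N -> 0 < L -> 0 < alpha -> s0 = 1 \/ s0 = -1 ->
  (forall y z, enorm (gradient f y - gradient f z) <= L * enorm (y - z)) ->
  orthant x ->
  let a := gamma / Num.sqrt N%:R in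
  let x' := sign_step s0 gamma f x in
  0 < a -> L * a * N%:R < 2 * h -> h * N%:R <= e ->
  alpha * e < residual alpha f x -> alpha * e < residual alpha f x' ->
  a * h <= \sum_i `|gradient f x 0 i| * `|(x' - x) 0 i|.
Proof.
move=> N0 L0 al hs lip ox a x' a0 Lah hN rx rx'.
rewrite leNgt; apply/negP => bad.
set g := gradient f x in bad *; set g' := gradient f x' in rx' *.
have h0 : 0 < h.
  rewrite -(pmulr_rgt0 h (ltr0Sn R 1)); apply: le_lt_trans Lah.
  exact: mulr_ge0 (mulr_ge0 (ltW L0) (ltW a0)) (ler0n _ _).
set d := x' - x in bad *.
have ox' : orthant x' by exact: sign_step_orthant.
have dE i : d 0 i = Num.max (x 0 i - a * sign s0 (g 0 i)) 0 - x 0 i.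
  by rewrite /d sub_coord /x' sign_step_coordE.
have da i : `|d 0 i| <= a.
  by rewrite dE; have [] := sign_step_coord s0 a _ (g 0 i) hs a0 (ox i).
have short i : `|d 0 i| < a -> x' 0 i = 0 /\ 0 <= g 0 i.
  rewrite dE /x' sign_step_coordE -/a -/g.
  by have [_ _] := sign_step_coord s0 a _ (g 0 i) hs a0 (ox i); apply.
have bsum : e < \sum_i `|g 0 i|.
  rewrite -(ltr_pM2l al); apply: (lt_le_trans rx).
  apply: (le_trans (residual_le_gradient _ _ _ al ox)).
  by rewrite ler_pM2l// enorm_le_sum.
have gd : enorm (g' - g) <= L * enorm d by exact: lip.
have [N2|N1] := ltnP 1 N; last first.
  (* The only coordinate is clipped, and its derivative, larger than e, drops
     by less than 2 e. *)
  have {}N1 : N = 1%N by apply/eqP; rewrite eqn_leq N1 N0.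
  pose i0 := Ordinal N0.
  have only (i : 'I_N) : i == i0.
    by apply/eqP/val_inj; move: (ltn_ord i) => /=; lia.
  have sum1 (F : 'I_N -> R) : \sum_i F i = F i0.
    by rewrite (big_pred1 i0)// => i; rewrite /= only.
  have enorm1 (v : 'rV[R]_N) : enorm v = `|v 0 i0|.
    by rewrite /enorm sum1 sqrtr_sqr.
  rewrite N1 !mulr1 in Lah hN.
  rewrite sum1 in bad; rewrite sum1 in bsum.
  have sh : `|d 0 i0| < a.
    rewrite ltNge; apply/negP => lg.
    have := le_lt_trans (ler_wpM2l (normr_ge0 (g 0 i0)) lg) bad.
    rewrite mulrC ltr_pM2l// => /lt_trans/(_ (le_lt_trans hN bsum)).
    by rewrite ltxx.
  have [x0 g0] := short i0 sh.
  move: rx'; rewrite /residual -/g' enorm1 proj_residual_coord x0.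
  apply/negP; rewrite -leNgt.
  apply: (le_trans (residual_coord_at0 alpha _ al)); rewrite ler_pM2l//.
  have e0 : 0 <= e := le_trans (ltW h0) hN.
  rewrite ge_max e0 andbT.
  move: gd; rewrite !enorm1 sub_coord ler_norml => /andP[+ _].
  have : L * `|d 0 i0| <= L * a by rewrite ler_pM2l// ltW.
  rewrite (ger0_norm g0) in bsum.
  move: Lah hN bsum; clear; move: (L * _) (L * a) (g 0 i0) (g' 0 i0) => *; lra.
(* w is |g| restricted to the unclipped coordinates; the new residual is
   dominated coordinatewise by alpha (w + |g' - g|). *)
pose w : 'rV[R]_N := \row_i (if `|d 0 i| < a then 0 else `|g 0 i|).
have w0 i : 0 <= w 0 i by rewrite mxE; case: ifP.
pose G := \sum_i w 0 i.
have wG : enorm w <= G.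
  apply: (le_trans (enorm_le_sum w)); apply: ler_sum => i _.
  by rewrite ger0_norm.
have res' : residual alpha f x' <= alpha * (G + L * enorm d).
  pose D : 'rV[R]_N := \row_i `|(g' - g) 0 i|.
  have DE : enorm D <= enorm (g' - g).
    by apply: enorm_le => i; rewrite mxE normr_id.
  apply: (@le_trans _ _ (enorm (alpha *: (w + D)))).
    apply: enorm_le => i.
    rewrite proj_residual_coord -/g' scale_coord normrM (gtr0_norm al).
    have -> : (w + D) 0 i = w 0 i + `|g' 0 i - g 0 i|.
      by rewrite -sub_coord [LHS]mxE [D 0 i]mxE.
    rewrite (ger0_norm (addr_ge0 (w0 i) (normr_ge0 _))).
    case: (ltP `|d 0 i| a) => [sh|lg].
      have [x0 g0] := short i sh.
      rewrite x0; apply: (le_trans (residual_coord_at0 alpha _ al)).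
      rewrite ler_pM2l// [w 0 i]mxE sh add0r.
      rewrite ge_max normr_ge0 andbT ler_normr; apply/orP; right.
      by rewrite opprB addrC lerDl.
    apply: (le_trans (residual_coord_le alpha _ _ al (ox' i))).
    rewrite ler_pM2l// [w 0 i]mxE ltNge lg /= addrC -lerBlDr.
    exact: lerB_dist.
  rewrite enormZ ?(ltW al)// ler_pM2l//.
  apply: (le_trans (enormD _ _)); apply: lerD => //.
  exact: (le_trans DE).
suff : G + L * enorm d <= e.
  by rewrite -(ler_pM2l al) => /(le_trans res')/(lt_le_trans rx'); rewrite ltxx.
pose j := [arg min_(i < Ordinal N0) `|d 0 i|]%O.
have jmin i : `|d 0 j| <= `|d 0 i|.
  by rewrite /j; case: arg_minP => // k _; apply.
apply: (@short_step_arith L a `|d 0 j| e h _ _ N%:R) => //.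
- by rewrite normr_ge0 da.
- exact: enorm_ge0.
- by rewrite (ler_nat _ 2).
- rewrite sqr_enorm (bigD1 j)//= real_normK ?num_real// lerD2l.
  apply: (@le_trans _ _ (\sum_(i | i != j) a ^+ 2)).
    apply: ler_sum => i _; rewrite -real_normK ?num_real// lerXn2r// ?nnegrE//.
    exact: ltW.
  rewrite sumr_const -[_ *+ _]mulr_natl ler_pM2r ?exprn_gt0//.
  by rewrite cardC1 card_ord -subn1 natrB.
- (* Unclipped coordinates move by a, the others by at least |d_j|. *)
  apply: le_lt_trans bad.
  apply: (@le_trans _ _ (a * G + `|d 0 j| * (\sum_i `|g 0 i| - G))).
    by rewrite lerD2l ler_wpM2l// lerD2r ltW.
  rewrite /G -sumrB !mulr_sumr -big_split /=; apply: ler_sum => i _.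
  rewrite mxE; case: (ltP `|d 0 i| a) => lg.
    by rewrite mulr0 add0r subr0 mulrC ler_wpM2l.
  by rewrite subrr mulr0 addr0 mulrC ler_wpM2l.
Qed.
End Progress.

(** * Decrease per iteration and the iteration bound *)

Section Bounds.
Context {R : realType} {N : nat}.
Implicit Types (x z : 'rV[R]_N) (f : 'rV[R]_N -> R).

Lemma optimal_valueE f z : solutions f z -> optimal_value f = f z.
Proof.
move=> [oz opt]; apply/eqP; rewrite eq_le; apply/andP; split.
  by apply: ge_inf; [exists (f z) => _ [y oy <-]; exact: opt|exists z].
by apply: lb_le_inf; [exists (f z), z|move=> _ [y oy <-]; exact: opt].
Qed.

Lemma powR_3half : N%:R `^ (3 / 2) = N%:R * Num.sqrt N%:R :> R.
Proof.
case: (posnP N) => [->|N0]; first by rewrite mul0r powR0//; lra.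
have -> : (3 / 2 : R) = 1 + 2^-1 by lra.
by rewrite powRD ?powRr1 ?ler0n ?powR12_sqrt// pnatr_eq0 -lt0n N0 implybT.
Qed.

(** The hypothesis eps < alpha B gives e <= B, hence N h <= e; it holds whenever
    some point of the orthant has a residual above eps. *)
Lemma sign_step_decrease (L B alpha s0 gamma eps : R) f x :
  (0 < N)%N -> 0 < L -> 0 < B -> 0 < alpha -> 0 < eps ->
  s0 = 1 \/ s0 = -1 -> F_class L f -> eps < alpha * B ->
  orthant x ->
  0 < gamma < 2 * eps ^+ 2 / (L * alpha ^+ 2 * B * N%:R `^ (3 / 2)) ->
  let x' := sign_step s0 gamma f x in
  eps < residual alpha f x -> eps < residual alpha f x' ->
  f x' <= f x -
    gamma * (2 * eps ^+ 2 - L * gamma * alpha ^+ 2 * B * N%:R `^ (3 / 2))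
    / (2 * alpha ^+ 2 * B * N%:R `^ (3 / 2)).
Proof.
move=> N0 L0 B0 al ep hs hf epB ox /andP[ga0] + x' rx rx'.
rewrite powR_3half; set n : R := N%:R; set q := Num.sqrt n.
have n0 : 0 < n by rewrite ltr0n.
have q0 : 0 < q by rewrite sqrtr_gt0.
have qq : q ^+ 2 = n by rewrite sqr_sqrtr ?ler0n.
rewrite ltr_pdivlMr; last by rewrite !mulr_gt0// exprn_gt0.
move=> hga.
have [qn nn aln Bn] : [/\ q != 0, n != 0, alpha != 0 & B != 0].
  by rewrite !gt_eqF.
pose e := eps / alpha; pose h := e ^+ 2 / (B * n); pose a := gamma / q.
have a0 : 0 < a by rewrite divr_gt0.
have ae : alpha * e = eps by rewrite mulrC divfK.
have hB : h * n * B = e ^+ 2 by rewrite /h; field; apply/andP.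
have e0 : 0 < e by rewrite divr_gt0.
have eB : e <= B by rewrite ler_pdivrMr// mulrC ltW.
have hn : h * n <= e.
  by rewrite -(ler_pM2r B0) hB expr2 ler_pM2l.
have Lah : L * a * n < 2 * h.
  rewrite -(ltr_pM2r (_ : 0 < alpha ^+ 2 * B * n)); last first.
    by rewrite !mulr_gt0// exprn_gt0.
  have -> : 2 * h * (alpha ^+ 2 * B * n) = 2 * eps ^+ 2.
    by rewrite /h /e; field; rewrite nn Bn aln.
  suff -> : L * a * n * (alpha ^+ 2 * B * n) =
     gamma * (L * alpha ^+ 2 * B * (n * q)) by [].
  by rewrite /a -qq; field.
have ae1 : alpha * e < residual alpha f x by rewrite ae.
have ae2 : alpha * e < residual alpha f x' by rewrite ae.
have prog := sign_step_progress L alpha s0 gamma e h f x N0 L0 al hs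
  (F_lipschitz hf) ox a0 Lah hn ae1 ae2.
have := descent_lemma L f x x' (F_differentiable hf) (F_lipschitz hf).
move=> /le_trans; apply.
have dE i := sign_step_coord s0 a (x 0 i) (gradient f x 0 i) hs a0 (ox i).
have lin : \sum_i gradient f x 0 i * (x' - x) 0 i <= - (a * h).
  rewrite lerNr -sumrN; apply: (le_trans prog); apply: ler_sum => i _.
  rewrite sub_coord /x' sign_step_coordE.
  by have [_ -> _] := dE i; rewrite opprK.
have quad : enorm (x' - x) ^+ 2 <= n * a ^+ 2.
  rewrite sqr_enorm.
  apply: (@le_trans _ _ (\sum_(i < N) a ^+ 2)); last first.
    by rewrite sumr_const card_ord -[_ *+ _]mulr_natl.
  apply: ler_sum => i _; rewrite -real_normK ?num_real//.
  rewrite lerXn2r ?nnegrE ?(ltW a0)// sub_coord /x' sign_step_coordE.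
  by have [] := dE i.
have -> : gamma * (2 * eps ^+ 2 - L * gamma * alpha ^+ 2 * B * (n * q)) /
    (2 * alpha ^+ 2 * B * (n * q)) = a * h - L / 2 * (n * a ^+ 2).
  by rewrite /a /h /e -qq; field; rewrite qn Bn aln.
rewrite -addrA lerD2l opprB addrC lerD//.
by rewrite ler_pM2l// divr_gt0.
Qed.

(** With M the coefficient of gamma, the values of gamma (2 eps ^ 2 - M gamma)
    at the vertex and at gamma differ by (eps ^ 2 - M gamma) ^ 2 / M. *)
Lemma iteration_bound_min (L B alpha eps gamma : R) f x :
  (0 < N)%N -> 0 < L -> 0 < B -> 0 < alpha -> 0 < eps ->
  optimal_value f <= f x ->
  let M := L * alpha ^+ 2 * B * N%:R `^ (3 / 2) in
  0 < gamma < 2 * eps ^+ 2 / M ->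
  iteration_bound L B alpha eps f x (eps ^+ 2 / M)
  <= iteration_bound L B alpha eps f x gamma.
Proof.
move=> N0 L0 B0 al ep fx M.
have r0 : 0 < N%:R `^ (3 / 2) :> R by rewrite powR_gt0// ltr0n.
have M0 : 0 < M by rewrite !mulr_gt0// exprn_gt0.
rewrite ltr_pdivlMr// => /andP[ga0 ga1].
rewrite /iteration_bound; apply: ceil_le.
have denE (g : R) :
    g * (2 * eps ^+ 2 - L * g * alpha ^+ 2 * B * N%:R `^ (3 / 2)) =
    g * (2 * eps ^+ 2 - M * g) by rewrite /M; ring.
rewrite !denE; apply: ler_wpM2l.
  by rewrite !mulr_ge0 ?subr_ge0 ?sqr_ge0 ?(ltW al) ?(ltW B0) ?(ltW r0) ?ler0n.
have den0 (g : R) : 0 < g -> g * M < 2 * eps ^+ 2 ->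
    g * (2 * eps ^+ 2 - M * g) \is Num.pos.
  by move=> g0 g1; rewrite posrE mulr_gt0// subr_gt0 mulrC.
have Mn : M != 0 by rewrite gt_eqF.
have ep2 : 0 < eps ^+ 2 by rewrite exprn_gt0.
rewrite lef_pV2 ?den0 ?divr_gt0//; last by rewrite divfK// ltr_pMl// ltr1n.
rewrite -subr_ge0.
have -> : eps ^+ 2 / M * (2 * eps ^+ 2 - M * (eps ^+ 2 / M)) -
    gamma * (2 * eps ^+ 2 - M * gamma) = (eps ^+ 2 - M * gamma) ^+ 2 / M.
  by field.
by rewrite divr_ge0 ?sqr_ge0// ltW.
Qed.
End Bounds.

Theorem theorem3 (R : realType) (N : nat) (hN : (1 <= N)%N)
    (L B alpha s0 : R) (hL : 0 < L) (hB : 0 < B) (halpha : 0 < alpha)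
    (hs0 : s0 = 1 \/ s0 = -1)
    (f : 'rV[R]_N -> R) (hf : F_class L f) (hgrad : gradient_bounded B f)
    (x0 : 'rV[R]_N) (hx0 : orthant x0) (eps : R) (heps : 0 < eps) :
  let gamma_max := 2 * eps ^+ 2 / (L * alpha ^+ 2 * B * N%:R `^ (3 / 2)) in
  let gamma_star := eps ^+ 2 / (L * alpha ^+ 2 * B * N%:R `^ (3 / 2)) in
  (forall gamma : R, 0 < gamma < gamma_max ->
     forall x : nat -> 'rV[R]_N,
       x 0%N = x0 ->
       (forall t : nat, x t.+1 = sign_step s0 gamma f (x t)) ->
       exists T : nat,
         approx_solutions alpha f eps (x T) /\
         T%:Z <= iteration_bound L B alpha eps f x0 gamma) /\
  (0 < gamma_star < gamma_max /\
   forall gamma : R, 0 < gamma < gamma_max ->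
     iteration_bound L B alpha eps f x0 gamma_star <=
     iteration_bound L B alpha eps f x0 gamma).
Proof.
have [xs sol] := F_solutions_nonempty hf.
have opt y : orthant y -> optimal_value f <= f y.
  by rewrite (optimal_valueE _ _ sol); exact: sol.2.
have r0 : 0 < N%:R `^ (3 / 2) :> R by rewrite powR_gt0// ltr0n.
have M0 : 0 < L * alpha ^+ 2 * B * N%:R `^ (3 / 2).
  by rewrite !mulr_gt0// exprn_gt0.
have ep2 : 0 < eps ^+ 2 by rewrite exprn_gt0.
move=> gamma_max gamma_star; split; last first.
  split; last by move=> gamma; apply: iteration_bound_min => //; exact: opt.
  by rewrite divr_gt0//= ltr_pM2r ?invr_gt0// ltr_pMl// ltr1n.
move=> gamma hga x xx0 xS.
have ox t : orthant (x t).
  by case: t => [|t]; [rewrite xx0|rewrite xS; exact: sign_step_orthant].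
pose den := gamma *
  (2 * eps ^+ 2 - L * gamma * alpha ^+ 2 * B * N%:R `^ (3 / 2)).
pose num := 2 * alpha ^+ 2 * B * N%:R `^ (3 / 2).
have num0 : 0 < num by rewrite !mulr_gt0// exprn_gt0.
have den0 : 0 < den.
  have /andP[ga0] := hga; rewrite ltr_pdivlMr// => ga1.
  rewrite mulr_gt0// subr_gt0; apply: le_lt_trans ga1.
  by rewrite le_eqVlt; apply/orP; left; apply/eqP; ring.
have bE : iteration_bound L B alpha eps f x0 gamma =
    Num.ceil ((f x0 - optimal_value f) / (den / num)).
  rewrite /iteration_bound -/den; congr Num.ceil.
  by rewrite /num; field; rewrite /num in num0; rewrite !gt_eqF.
set K := iteration_bound _ _ _ _ _ _ _ in bE *.
have K0 : 0 <= K.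
  by rewrite bE -(ceil0 R) ceil_le// divr_ge0 ?subr_ge0 ?opt// ltW// divr_gt0.
apply: contrapT => /forallNP none.
have far t : (t <= `|K|)%N -> eps < residual alpha f (x t).
  move=> tK; rewrite ltNge; apply/negP => rt; apply: (none t); split => //.
  by rewrite -(gez0_abs K0) lez_nat.
have epB : eps < alpha * B.
  apply: (lt_le_trans (far 0%N isT)).
  apply: (le_trans (residual_le_gradient _ _ _ halpha (ox 0%N))).
  by rewrite ler_pM2l//; exact: hgrad.
have dec t : (t <= `|K|)%N -> f (x t) <= f x0 - t%:R * (den / num).
  elim: t => [|t IH] tK; first by rewrite xx0 mul0r subr0.
  have := IH (ltnW tK).
  have := @sign_step_decrease R N L B alpha s0 gamma eps f (x t) hN hL hB
    halpha heps hs0 hf epB (ox t) hga (far _ (ltnW tK)).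
  rewrite -xS => /(_ (far _ tK)); rewrite -/den -/num -[t.+1]addn1 natrD; lra.
have fle : f (x `|K|%N) <= optimal_value f.
  apply: (le_trans (dec _ (leqnn _))).
  rewrite lerBlDr -lerBlDl -ler_pdivrMr ?divr_gt0//.
  have -> : `|K|%:R = K%:~R :> R by rewrite -[in RHS](gez0_abs K0).
  by rewrite bE ceil_ge.
have solK : solutions f (x `|K|%N).
  by split=> // y oy; apply: (le_trans fle); exact: opt.
have := far _ (leqnn _).
by rewrite (minimizer_residual0 _ _ _ _ hL halpha hf solK) ltNge ltW.
Qed.
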